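(* Let $(a_l)_{l\geq1}$ and $(b_l)_{l\geq1}$ be sequences of real numbers and let $n\geq k\geq r\geq 1$ be integers. Then $$B^{(r)}_{n,k}(a_1,a_2,\ldots;b_1,b_2,\ldots)=\frac{(n-r)!}{(k-r)!}\sum_{\substack{(n_1,\ldots,n_k)\in\mathbb{N}^k\\ n_1+\cdots+n_k=n-k}}\frac{b_{n_1+1}\cdots b_{n_r+1}}{n_1!\cdots n_r!}\cdot\frac{a_{n_{r+1}+1}\cdots a_{n_k+1}}{(n_{r+1}+1)!\cdots(n_k+1)!}.$$
   Context: For sequences $a=(a_l)_{l\geq1}$, $b=(b_l)_{l\geq1}$ and integers $N,K,r\geq0$, the partial $r$-Bell polynomial is $$B^{(r)}_{N,K}(a_1,a_2,\ldots;b_1,b_2,\ldots)=\sum_{\pi}\ \prod_{B\in\pi,\ B\cap\{1,\ldots,r\}=\emptyset}a_{|B|}\prod_{B\in\pi,\ B\cap\{1,\ldots,r\}\neq\emptyset}b_{|B|},$$ where $\pi$ ranges over the partitions of $\{1,\ldots,N\}$ into exactly $K$ nonempty blocks such that $1,\ldots,r$ lie in pairwise distinct blocks (an empty sum is $0$; the empty partition of the empty set contributes $1$). For nonnegative integer sequences this is the number of such partitions in which each block of size $i$ containing none of $1,\ldots,r$ is colored with one of $a_i$ colors and each block of size $i$ containing one of $1,\ldots,r$ is colored with one of $b_i$ colors. Here $\mathbb{N}=\{0,1,2,\ldots\}$. *)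

(* Defs.v *)
From HB Require Import structures.
From mathcomp Require Import all_boot all_order all_algebra.
From mathcomp Require Import reals.

Set Implicit Arguments.
Unset Strict Implicit.
Unset Printing Implicit Defensive.

Import Order.TTheory GRing.Theory Num.Theory.

Local Open Scope ring_scope.

(* The set {1, ..., N} is modelled by 'I_N: the element i stands for i + 1.
   Hence {1, ..., r} becomes the set of i with i < r. *)
Definition distinguished (N r : nat) : {set 'I_N} := [set i : 'I_N | (i < r)%N].

(* The condition r <= N says that 1, ..., r are elements of the ground set, so
   that each of them lies in some block. *)
Definition r_partition (N K r : nat) (P : {set {set 'I_N}}) : bool :=
  [&& (r <= N)%N,
      partition P [set: 'I_N],
      #|P| == K
    & [forall i in distinguished N r, forall j in distinguished N r,
         (i != j) ==> (pblock P i != pblock P j)]].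

(* Sequences indexed by l >= 1 are functions on nat; blocks are nonempty, so
   the values a 0 and b 0 are never used. *)
Definition r_bell (R : realType) (N K r : nat) (a b : nat -> R) : R :=
  \sum_(P : {set {set 'I_N}} | r_partition K r P)
     (\prod_(B in P | B :&: distinguished N r == set0) a #|B|) *
     (\prod_(B in P | B :&: distinguished N r != set0) b #|B|).

(* Main.v *)
Require Import Defs.
From HB Require Import structures.
From mathcomp Require Import all_boot all_order all_algebra.
From mathcomp Require Import fingroup perm.
From mathcomp Require Import reals.

Set Implicit Arguments.
Unset Strict Implicit.
Unset Printing Implicit Defensive.

Import Order.TTheory GRing.Theory Num.Theory.

Local Open Scope ring_scope.

(* Both sides, multiplied by (k - r)!, count by weight the surjections
   f : {1, ..., n} -> {1, ..., k} with f i = i for i <= r. Grouping them by the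
   partition into fibers gives the left-hand side, since each admissible
   partition comes from (k - r)! surjections: permute the labels r + 1, ..., k.
   Grouping them by the fiber sizes n_j + 1 gives the right-hand side, since f
   is determined by its restriction to {r + 1, ..., n}, whose fibers have sizes
   n_j for j <= r and n_j + 1 for j > r, which leaves a multinomial coefficient
   with numerator (n - r)!. *)

(** * Functions with prescribed fiber sizes *)

Definition fiber (T I : finType) (f : {ffun T -> I}) (j : I) : {set T} :=
  [set x | f x == j].

Lemma sum_card_fiber (T I : finType) (f : {ffun T -> I}) :
  (\sum_j #|fiber f j| = #|T|)%N.
Proof.
rewrite -sum1_card (partition_big f predT) //=; apply: eq_bigr => j _.
by rewrite sum1dep_card.
Qed.

Definition ffun_cons (I : finType) (N : nat) (i : I) (g : {ffun 'I_N -> I}) :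
    {ffun 'I_N.+1 -> I} :=
  [ffun x => if unlift ord0 x is Some y then g y else i].

Lemma card_fiber_cons (I : finType) (N : nat) (i : I) (g : {ffun 'I_N -> I}) j :
  (#|fiber (ffun_cons i g) j| = (i == j) + #|fiber g j|)%N.
Proof.
rewrite /fiber -!sum1dep_card big_mkcond big_ord_recl ffunE unlift_none.
congr addn.
by rewrite [RHS]big_mkcond; apply: eq_bigr => x _; rewrite ffunE liftK.
Qed.

(** The multinomial coefficient, in product form to avoid division. Induction on [N], splitting on
    the value [i] taken at [ord0]: the functions with that value contribute [d i * N!], and these
    add up to [(N + 1)!] because the [d i] sum to [N + 1]. *)
Lemma card_ffun_fibers (I : finType) (N : nat) (d : I -> nat) :
    (\sum_j d j = N)%N ->
  (#|[set f : {ffun 'I_N -> I} | [forall j, #|fiber f j| == d j]]|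
     * \prod_j (d j)`! = N`!)%N.
Proof.
elim: N d => [|N IHN] d sumd.
  have d0 j : d j = 0%N by move/eqP: sumd; rewrite sum_nat_eq0 => /forallP/(_ j)/eqP.
  rewrite big1 => [|j _]; last by rewrite d0.
  rewrite muln1 (_ : [set _ | _] = setT) ?cardsT ?card_ffun ?card_ord //.
  apply/setP=> f; rewrite !inE; apply/forallP=> j.
  by rewrite d0 cards_eq0 -subset0; apply/subsetP=> -[].
rewrite -sum1dep_card (partition_big (fun f : {ffun _ -> I} => f ord0) predT) //=.
rewrite big_distrl /= factS -[in RHS]sumd [RHS]big_distrl /=; apply: eq_bigr => i _.
rewrite (reindex_onto (ffun_cons i) (fun f => [ffun y => f (lift ord0 y)])) /=; last first.
  move=> f /andP[_ /eqP fi]; apply/ffunP=> x; rewrite ffunE.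
  by case: unliftP => [y|] ->; rewrite ?ffunE.
(* The sizes still to be filled once [ord0] has been sent to [i]. The subtraction is exact only for
   [0 < d i]; if [d i = 0], no function sends [ord0] to [i] and both terms vanish. *)
pose e j := (d j - (i == j))%N.
have [di0|di_gt0] := posnP (d i).
  rewrite di0 mul0n big_pred0 // => g; apply/negP => /andP[/andP[/forallP/(_ i)]].
  by rewrite card_fiber_cons eqxx di0.
have dE j : d j = ((i == j) + e j)%N.
  by rewrite subnKC //; case: eqP => [<-|].
have sume : (\sum_j e j = N)%N.
  move: sumd; rewrite (eq_bigr _ (fun j _ => dE j)) big_split /= (bigD1 i) //=.
  rewrite eqxx big1 => [|j /negPf]; first by rewrite addn0 add1n => -[].
  by rewrite eq_sym => ->.
rewrite (eq_bigl (fun g => [forall j, #|fiber g j| == e j])); last first.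
  move=> g; rewrite {2}/ffun_cons ffunE unlift_none eqxx andbT.
  have -> : [ffun y => ffun_cons i g (lift ord0 y)] == g.
    by apply/eqP/ffunP=> y; rewrite !ffunE liftK.
  rewrite andbT; apply: eq_forallb => j.
  by rewrite card_fiber_cons dE eqn_add2l.
rewrite sum1dep_card -(IHN _ sume) mulnCA; congr muln.
rewrite (bigD1 i) //= [in RHS](bigD1 i) //= mulnA; congr muln.
  by rewrite dE eqxx add1n factS.
by apply: eq_bigr => j; rewrite eq_sym dE => /negPf->.
Qed.

(** * Partitions as fibers of labellings *)

Definition kernel (T I : finType) (f : {ffun T -> I}) : {set {set T}} :=
  [set fiber f j | j : I].

(** The fiber of [f] through [x] and [y] is also a fiber of [g]. *)
Lemma kernel_eq (T I J : finType) (f : {ffun T -> I}) (g : {ffun T -> J}) x y :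
  kernel f = kernel g -> f x = f y -> g x = g y.
Proof.
move=> kfg fxy; have : fiber f (f x) \in kernel g by rewrite -kfg imset_f.
case/imsetP=> j _ /setP Ej; move: (Ej x) (Ej y).
by rewrite !inE fxy !eqxx => /esym/eqP-> /esym/eqP->.
Qed.

(* A labelling numbers the blocks of a partition by 'I_k so that the block
   containing the distinguished element i gets the number i. *)
Definition labelling (n k r : nat) (f : {ffun 'I_n -> 'I_k}) : bool :=
  [forall j, fiber f j != set0]
    && [forall i : 'I_n, (i < r)%N ==> (f i == i :> nat)].

Lemma labellingP (n k r : nat) (f : {ffun 'I_n -> 'I_k}) :
  reflect ((forall j, exists x, f x = j) /\
           (forall i : 'I_n, (i < r)%N -> f i = i :> nat))
          (labelling r f).
Proof.
apply: (iffP andP) => [[/forallP f_onto /forallP fr]|[f_onto fr]]; split.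
- by move=> j; have /set0Pn[x] := f_onto j; rewrite inE => /eqP; exists x.
- by move=> i lt_ir; apply/eqP; apply: (implyP (fr i)).
- by apply/forallP=> j; apply/set0Pn; have [x <-] := f_onto j; exists x; rewrite inE.
by apply/forallP=> i; apply/implyP=> /fr->.
Qed.

Lemma fiber_inj (n k r : nat) (f : {ffun 'I_n -> 'I_k}) :
  labelling r f -> injective (fiber f).
Proof.
case/labellingP=> f_onto _ i j /setP; have [x <-] := f_onto i.
by move/(_ x); rewrite !inE eqxx => /esym/eqP.
Qed.

Lemma kernel_r_partition (n k r : nat) (f : {ffun 'I_n -> 'I_k}) :
  (r <= n)%N -> labelling r f -> r_partition k r (kernel f).
Proof.
move=> le_rn lf; have [f_onto fr] := labellingP _ _ lf.
have tI : trivIset (kernel f).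
  apply/trivIsetP=> _ _ /imsetP[i _ ->] /imsetP[j _ ->] neq.
  rewrite -setI_eq0; apply/eqP/setP=> x; rewrite !inE; apply/andP=> -[/eqP fx].
  by rewrite fx => /eqP Eij; rewrite Eij eqxx in neq.
have pbE x : pblock (kernel f) x = fiber f (f x).
  by apply: def_pblock; rewrite ?imset_f ?inE.
apply/and4P; split=> //.
- apply/and3P; split=> //.
    apply/eqP/setP=> x; rewrite inE; apply/bigcupP.
    by exists (fiber f (f x)); rewrite ?imset_f ?inE.
  apply/imsetP=> -[j _ /setP E0]; have [x fx] := f_onto j.
  by have := E0 x; rewrite !inE fx eqxx.
- by rewrite card_imset ?cardsT ?card_ord //; apply: fiber_inj lf.
(* Distinct distinguished elements keep distinct labels, hence lie in distinct fibers. *)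
apply/forallP=> i; rewrite inE; apply/implyP=> lt_ir.
apply/forallP=> j; rewrite inE; apply/implyP=> lt_jr; apply/implyP.
apply: contraNneq; rewrite !pbE => /(fiber_inj lf)/(congr1 val) /=.
by rewrite !fr // => /val_inj->.
Qed.

(** List the blocks of the distinguished elements in order, then the remaining blocks; the position
    of a block in this list is its label. Writing the ground set as ['I_(r + p)] makes the
    distinguished elements the image of [lshift p]. *)
Lemma labelling_exists (p k r : nat) (P : {set {set 'I_(r + p)}}) :
  r_partition k r P -> exists2 f : {ffun 'I_(r + p) -> 'I_k},
    labelling r f & kernel f = P.
Proof.
case/and4P=> _ partP /eqP cardP sepP.
have /and3P[/eqP covP tI P0] := partP.
have pbP x : pblock P x \in P by rewrite pblock_mem // covP.
pose h (i : 'I_r) := pblock P (lshift p i).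
have h_inj : injective h.
  move=> i j Eh; apply/(@lshift_inj r p)/eqP; apply: contraTT isT => neq.
  have /forallP/(_ (lshift p i)) := sepP; rewrite inE /= ltn_ord /=.
  by move/forallP/(_ (lshift p j)); rewrite inE /= ltn_ord /= neq /= -/(h i) Eh eqxx.
(* Since [h] is injective, [s] enumerates [P] without repetition, and the block of the distinguished
   element [i] sits at index [i]. *)
pose s := codom h ++ enum (P :\: [set B in codom h]).
have mem_s : s =i P.
  move=> B; rewrite mem_cat mem_enum !inE.
  have [/codomP[i ->]|//] := boolP (B \in codom h).
  by rewrite pbP.
have s_uniq : uniq s.
  rewrite cat_uniq enum_uniq map_inj_uniq // enum_uniq andbT /=.
  by apply/hasPn=> B; rewrite mem_enum !inE => /andP[].
have size_s : size s = k.
  by rewrite -cardP -(card_uniqP s_uniq); apply: eq_card.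
have ltk x : (index (pblock P x) s < k)%N by rewrite -size_s index_mem mem_s.
pose f : {ffun 'I_(r + p) -> 'I_k} := [ffun x => Ordinal (ltk x)].
have nthP (j : 'I_k) : nth set0 s j \in P by rewrite -mem_s mem_nth // size_s.
have fiberE j : fiber f j = nth set0 s j.
  apply/setP=> x; rewrite inE ffunE -val_eqE /=; apply/eqP/idP => [<-|xB].
    by rewrite nth_index ?mem_s // mem_pblock covP.
  by rewrite (def_pblock tI _ xB) // index_uniq // size_s.
exists f.
  apply/labellingP; split=> [j|i lt_ir].
    have /set0Pn[x] : fiber f j != set0 by rewrite fiberE; apply: contraNneq P0 => <-.
    by rewrite inE => /eqP; exists x.
  rewrite ffunE /=; have -> : i = lshift p (Ordinal lt_ir) by apply: val_inj.
  rewrite -/(h _) index_cat codom_f /= index_map // index_enum_ord //.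
apply/setP=> B; apply/imsetP/idP => [[j _ ->]|BP]; first by rewrite fiberE.
have lt_Bk : (index B s < k)%N by rewrite -size_s index_mem mem_s.
by exists (Ordinal lt_Bk); rewrite // fiberE nth_index ?mem_s.
Qed.

Lemma card_ord_lt (k r : nat) (le_rk : (r <= k)%N) :
  #|[set j : 'I_k | (j < r)%N]| = r.
Proof.
have inj_widen : injective (widen_ord le_rk).
  by move=> i j /(congr1 val) Eij; apply: val_inj.
rewrite -[RHS](card_ord r) -(card_imset _ inj_widen).
apply: eq_card => j; rewrite inE; apply/idP/imsetP => [lt_jr|[i _ ->]] //=.
by exists (Ordinal lt_jr); last apply: val_inj.
Qed.

(** Fix one labelling [f0] of [P]. The others are its composites with the permutations of the labels
    that move only labels in [A], and distinct permutations give distinct labellings because [f0] is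
    onto. *)
Lemma card_labellings (p k r : nat) (P : {set {set 'I_(r + p)}}) :
    (r <= k)%N -> r_partition k r P ->
  #|[set f : {ffun 'I_(r + p) -> 'I_k} | labelling r f & kernel f == P]|
    = (k - r)`!.
Proof.
move=> le_rk /labelling_exists[f0 lf0 kf0].
have [f0_onto f0r] := labellingP _ _ lf0.
pose A := [set j : 'I_k | (r <= j)%N].
have cardA : #|A| = (k - r)%N.
  apply: (@addnI r); rewrite subnKC // -{1}(card_ord_lt le_rk) -[RHS](card_ord k).
  by rewrite -(cardsC [set j : 'I_k | (j < r)%N]); congr addn; apply: eq_card => j;
    rewrite !inE -leqNgt.
rewrite -cardA -card_perm.
pose c (s : {perm 'I_k}) : {ffun 'I_(r + p) -> 'I_k} := [ffun x => s (f0 x)].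
have c_inj : injective c.
  move=> s t /ffunP Est; apply/permP=> j; have [x <-] := f0_onto j.
  by have := Est x; rewrite !ffunE.
rewrite -(card_imset _ c_inj); apply: eq_card => f; rewrite inE.
apply/andP/imsetP => [[lf /eqP kf]|[s sA ->]]; last first.
  split.
    apply/labellingP; split=> [j|i lt_ir].
      have [x fx] := f0_onto (s^-1%g j); exists x.
      by rewrite ffunE fx permKV.
    by rewrite ffunE (out_perm sA) ?f0r // inE f0r // -ltnNge.
  have fib j : fiber (c s) j = fiber f0 (s^-1%g j).
    by apply/setP=> x; rewrite !inE ffunE -(inj_eq (@perm_inj _ s) (f0 x)) permKV.
  rewrite -kf0; apply/eqP/setP=> B; apply/imsetP/imsetP=> -[j _ ->].
    by exists (s^-1%g j).
  by exists (s j); rewrite // fib permK.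
have [f_onto fr] := labellingP _ _ lf.
have Ek : kernel f = kernel f0 by rewrite kf kf0.
have ex j : exists x, f0 x == j by have [x <-] := f0_onto j; exists x.
(* The permutation carrying [f0] to [f]: relabel [j] by the value of [f] at any point that [f0]
   labels [j]. The choice is irrelevant because the kernels agree. *)
pose g j := f (xchoose (ex j)).
have gE x : g (f0 x) = f x.
  by apply: (kernel_eq (esym Ek)); apply/eqP/(xchooseP (ex (f0 x))).
have g_inj : injective g.
  move=> i j; have [x <-] := f0_onto i; have [y <-] := f0_onto j.
  by rewrite !gE; apply: kernel_eq.
exists (perm g_inj); last by apply/ffunP=> x; rewrite ffunE permE gE.
(* A label [j < r] is fixed, since both labellings give it to the distinguished element [j]. *)
apply/subsetP=> j; rewrite !inE permE; apply: contraNT; rewrite -ltnNge => lt_jr.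
pose x := lshift p (Ordinal lt_jr); have xr : (x < r)%N by [].
have <- : f0 x = j by apply: val_inj; rewrite /= f0r.
by rewrite gE; apply/eqP/val_inj; rewrite /= fr ?f0r.
Qed.

(** * Labellings with prescribed fiber sizes *)

Definition ffun_shift (p k r : nat) (le_rk : (r <= k)%N)
    (g : {ffun 'I_p -> 'I_k}) : {ffun 'I_(r + p) -> 'I_k} :=
  [ffun x => match split x with inl i => widen_ord le_rk i | inr y => g y end].

Lemma ffun_shiftl p k r (le_rk : (r <= k)%N) (g : {ffun 'I_p -> 'I_k}) i :
  ffun_shift le_rk g (lshift p i) = widen_ord le_rk i.
Proof. by rewrite ffunE (unsplitK (inl i)). Qed.

Lemma ffun_shiftr p k r (le_rk : (r <= k)%N) (g : {ffun 'I_p -> 'I_k}) y :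
  ffun_shift le_rk g (rshift r y) = g y.
Proof. by rewrite ffunE (unsplitK (inr y)). Qed.

Lemma card_fiber_shift p k r (le_rk : (r <= k)%N) (g : {ffun 'I_p -> 'I_k}) j :
  #|fiber (ffun_shift le_rk g) j| = ((j < r) + #|fiber g j|)%N.
Proof.
rewrite /fiber -!sum1dep_card big_mkcond big_split_ord /=; congr addn; last first.
  by rewrite [RHS]big_mkcond; apply: eq_bigr => y _; rewrite ffun_shiftr.
under eq_bigr => i _ do rewrite ffun_shiftl -val_eqE /=.
have [lt_jr|le_rj] := ltnP j r; last first.
  by rewrite big1 // => i _; rewrite ltn_eqF // (leq_trans (ltn_ord i)).
rewrite (bigD1 (Ordinal lt_jr)) //= eqxx big1 // => i.
by rewrite -val_eqE /= => /negPf->.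
Qed.

Lemma card_labellings_fibers (p k r : nat) (m : 'I_k -> nat) :
    (r <= k)%N -> (\sum_j (m j).+1 = r + p)%N ->
  (#|[set f : {ffun 'I_(r + p) -> 'I_k} |
       labelling r f & [forall j, #|fiber f j| == (m j).+1]]|
     * (\prod_(j < k | j < r) (m j)`! * \prod_(j < k | r <= j) (m j).+1`!)
   = p`!)%N.
Proof.
move=> le_rk summ.
(* For [j < r] the distinguished element [j] already occupies one place of fiber [j], so the
   restriction to the other elements has [m j] points there, against [m j + 1] for [r <= j]. *)
pose d (j : 'I_k) := ((m j).+1 - (j < r))%N.
have dE (j : 'I_k) : ((m j).+1 = (j < r) + d j)%N by rewrite subnKC //; case: (j < r)%N.
have sum_lt : (\sum_(j < k) (j < r) = r)%N.
  by rewrite -[RHS](card_ord_lt le_rk) -sum1dep_card [RHS]big_mkcond.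
have sumd : (\sum_j d j = p)%N.
  apply: (@addnI r); rewrite -summ (eq_bigr _ (fun j _ => dE j)) big_split /=.
  by rewrite sum_lt.
rewrite -(card_ffun_fibers sumd) (bigID (fun j : 'I_k => (j < r)%N) predT) /=.
congr muln; last first.
  congr muln; last under eq_bigl do rewrite leqNgt.
    by apply: eq_bigr => j; rewrite /d => ->; rewrite subn1.
  by apply: eq_bigr => j; rewrite /d => /negPf->; rewrite subn0.
have sh_inj : injective (@ffun_shift p k r le_rk).
  move=> g h /ffunP E; apply/ffunP=> y; have := E (rshift r y).
  by rewrite !ffun_shiftr.
rewrite -(card_imset _ sh_inj); apply: eq_card => f; rewrite inE.
apply/andP/imsetP => [[lf /forallP fm]|[g]].
  have [_ fr] := labellingP _ _ lf.
  (* A labelling is determined by its restriction to the elements that are not distinguished. *)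
  have Ef : f = ffun_shift le_rk [ffun y => f (rshift r y)].
    apply/ffunP=> x; rewrite -(splitK x).
    case: (split x) => [i|y] /=; last by rewrite ffun_shiftr ffunE.
    by rewrite ffun_shiftl; apply: val_inj; rewrite /= fr /=.
  exists [ffun y => f (rshift r y)] => //; rewrite inE; apply/forallP=> j.
  by have := fm j; rewrite {1}Ef card_fiber_shift dE eqn_add2l.
rewrite inE => /forallP gd ->.
have cf j : #|fiber (ffun_shift le_rk g) j| = (m j).+1.
  by rewrite card_fiber_shift (eqP (gd j)) dE.
split; last by apply/forallP=> j; rewrite cf.
apply/andP; split; apply/forallP=> j; first by rewrite -card_gt0 cf.
apply/implyP=> lt_jr; have -> : j = lshift p (Ordinal lt_jr) by apply: val_inj.
by rewrite ffun_shiftl.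
Qed.

(** * Weights and the double count *)

Lemma kernel_weight (R : realType) (a b : nat -> R) (p k r : nat)
    (f : {ffun 'I_(r + p) -> 'I_k}) :
    labelling r f ->
  (\prod_(B in kernel f | B :&: distinguished (r + p) r == set0) a #|B|) *
  (\prod_(B in kernel f | B :&: distinguished (r + p) r != set0) b #|B|)
  = (\prod_(j < k | (j < r)%N) b #|fiber f j|) *
    (\prod_(j < k | (r <= j)%N) a #|fiber f j|).
Proof.
move=> lf; have [f_onto fr] := labellingP _ _ lf.
(* If [j < r], fiber [j] contains the distinguished element [j]; conversely a distinguished element
   in fiber [j] equals [j], which forces [j < r]. *)
have meetE (j : 'I_k) : (fiber f j :&: distinguished (r + p) r == set0) = (r <= j)%N.
  rewrite leqNgt; apply/eqP/negP => [/setP E0 lt_jr|ge_rj].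
    have := E0 (lshift p (Ordinal lt_jr)).
    by rewrite !inE /= lt_jr andbT -val_eqE /= fr //= eqxx.
  apply/setP=> x; rewrite !inE; apply/andP=> -[/eqP fx lt_xr].
  by apply: ge_rj; rewrite -fx fr.
have prodE (Q : pred {set 'I_(r + p)}) (c : nat -> R) :
    \prod_(B in kernel f | Q B) c #|B| = \prod_(j < k | Q (fiber f j)) c #|fiber f j|.
  rewrite big_mkcondr big_imset /= -?big_mkcondr => [|i j _ _]; last first.
    exact: fiber_inj lf _ _.
  by apply: eq_bigl.
rewrite !prodE mulrC; congr (_ * _); apply: eq_bigl => j; rewrite meetE //.
by rewrite ltnNge.
Qed.

(* A tuple in N^k with sum n - k has all its entries at most n - k, so the
   tuples range over {ffun 'I_k -> 'I_(n - k).+1}. *)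
Theorem theorem2 (R : realType) (a b : nat -> R) (n k r : nat)
    (hkn : (k <= n)%N) (hrk : (r <= k)%N) (hr : (1 <= r)%N) :
  r_bell n k r a b =
    ((n - r)`!%:R / (k - r)`!%:R) *
    \sum_(m : {ffun 'I_k -> 'I_(n - k).+1} | (\sum_(i < k) m i == n - k)%N)
       ((\prod_(i < k | (i < r)%N) b (m i).+1) /
        (\prod_(i < k | (i < r)%N) (m i)`!%:R)) *
       ((\prod_(i < k | (r <= i)%N) a (m i).+1) /
        (\prod_(i < k | (r <= i)%N) ((m i).+1)`!%:R)).
Proof.
have factN0 q : q`!%:R != 0 :> R by rewrite pnatr_eq0 -lt0n fact_gt0.
have [p En] : exists p, n = (r + p)%N.
  by exists (n - r)%N; rewrite subnKC // (leq_trans hrk).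
subst n; rewrite addKn -mulrA mulrCA.
(* Clearing the denominator [(k - r)!] turns both sides into the weighted count of labellings. *)
apply: (mulfI (factN0 (k - r)%N)); rewrite mulVKf //.
pose W (f : {ffun 'I_(r + p) -> 'I_k}) :=
  (\prod_(j < k | (j < r)%N) b #|fiber f j|) *
  (\prod_(j < k | (r <= j)%N) a #|fiber f j|).
transitivity (\sum_(f : {ffun 'I_(r + p) -> 'I_k} | labelling r f) W f).
  rewrite (partition_big (@kernel _ _) (r_partition k r)) => [|f]; last first.
    exact/kernel_r_partition/leq_addr.
  rewrite mulr_sumr; apply: eq_bigr => P rP.
  rewrite -(card_labellings hrk rP) mulr_natl -sumr_const big_set.
  by apply: eq_bigr => f /andP[lf /eqP <-]; rewrite kernel_weight.
(* Fibers of a labelling are nonempty and their sizes less one sum to [r + p - k], so the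
   predecessor and [inord] lose nothing; [szE] records this. *)
pose sz (f : {ffun 'I_(r + p) -> 'I_k}) : {ffun 'I_k -> 'I_(r + p - k).+1} :=
  [ffun j => inord #|fiber f j|.-1].
have sum_pred (f : {ffun 'I_(r + p) -> 'I_k}) :
    labelling r f -> (\sum_j #|fiber f j|.-1 = r + p - k)%N.
  case/andP=> /forallP fN0 _.
  have := sum_card_fiber f; rewrite card_ord => sumf.
  rewrite -[X in _ = (X - _)%N]sumf -[X in _ = (_ - X)%N](card_ord k) -sum1_card.
  rewrite -sumnB => [|j _]; last by rewrite card_gt0.
  by apply: eq_bigr => j _; rewrite subn1.
have szE f j : labelling r f -> (sz f j).+1 = #|fiber f j|.
  move=> lf; have fN0 : (0 < #|fiber f j|)%N.
    by rewrite card_gt0; case/andP: lf => /forallP.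
  rewrite ffunE inordK ?prednK // -(sum_pred f lf) (bigD1 j) //=.
  by rewrite -[X in (X <= _)%N](prednK fN0) leq_addr.
rewrite (partition_big sz (fun m => \sum_(i < k) m i == r + p - k)%N) => [|f lf]; last first.
  apply/eqP; rewrite -[RHS](sum_pred f lf); apply: eq_bigr => j _.
  by rewrite -szE.
rewrite mulr_sumr; apply: eq_bigr => m /eqP summ.
have sumS : (\sum_(j < k) (m j).+1 = r + p)%N.
  under eq_bigr do rewrite -addn1.
  by rewrite big_split /= summ sum1_card card_ord subnK.
(* Expanding [p!] as the number of labellings with sizes [m] times the factorials cancels the
   denominators; all these labellings have the same weight. *)
rewrite -(card_labellings_fibers hrk sumS) !natrM !natr_prod.
rewrite (eq_bigr (fun=> (\prod_(i < k | (i < r)%N) b (m i).+1) *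
                        (\prod_(i < k | (r <= i)%N) a (m i).+1))); last first.
  by move=> f /andP[lf /eqP <-]; congr (_ * _); apply: eq_bigr => j _; rewrite szE.
rewrite (eq_bigl (mem [set f : {ffun 'I_(r + p) -> 'I_k} |
       labelling r f & [forall j, #|fiber f j| == (m j).+1]])); last first.
  move=> f; rewrite !inE; case lf: (labelling r f) => //=.
  apply/eqP/forallP=> [<- j|fm]; first by rewrite szE.
  by apply/ffunP=> j; apply: val_inj; apply: succn_inj; rewrite szE // (eqP (fm j)).
rewrite sumr_const -[LHS]mulr_natl mulf_div -!mulrA; congr (_ * _).
rewrite [RHS]mulrA [X in _ = _ * X]mulrA [RHS]mulrC divfK //.
by rewrite mulf_neq0 //; apply/prodf_neq0.
Qed.
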